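(* Let $n,d\geq1$ be integers, $t_{n,d}=\frac{d}{n+1}$, and let $t\in(0,t_{n,d})$ be rational. A pair $(X,H)$ is not $t$-stable (respectively, is $t$-unstable) if and only if there exist $g\in\mathrm{SL}(n+2,\mathbb K)$, $\lambda\in S_{n,d}$ and $0\leq i\leq n+1$ such that the sets of monomials associated to $(g\cdot X,g\cdot H)$ are contained in the pair of sets $N^\oplus_t(\lambda,x_i)$ (respectively, $N^+_t(\lambda,x_i)$). Furthermore, those $N^\oplus_t(\lambda,x_i)$ (respectively $N^+_t(\lambda,x_i)$), with $\lambda\in S_{n,d}$ and $0\leq i\leq n+1$, which are maximal with respect to the (componentwise) containment order define families of non-$t$-stable pairs (respectively $t$-unstable pairs), the family defined by a pair of sets being the set of all pairs $(X,H)$ whose associated sets of monomials are contained in it. For any not $t$-stable (respectively $t$-unstable) pair $(X,H)$ there is $g\in \mathrm{SL}(n+2,\mathbb K)$ such that $(g\cdot X,g\cdot H)$ belongs to one of these families.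
   Context: $\mathbb K$ is an algebraically closed field and $G=\mathrm{SL}(n+2,\mathbb K)$ acts on $\mathbb P^{n+1}$ with fixed homogeneous coordinates $x_0,\dots,x_{n+1}$. A pair $(X,H)$ consists of a hypersurface $X\subset\mathbb P^{n+1}$ of degree $d$ (zero scheme of a nonzero form $F=\sum_I c_Ix^I$) and a hyperplane $H=\{\sum h_ix_i=0\}$. Its associated sets of monomials are $\mathcal X=\{x^I\in\Xi_d\mid c_I\neq0\}$, $\mathcal H=\{x_i\in\Xi_1\mid h_i\neq0\}$, where $\Xi_k$ is the set of monomials of degree $k$ in $x_0,\ldots,x_{n+1}$. The set $\Xi_1$ is totally ordered by $x_0>x_1>\cdots>x_{n+1}$. The pair $(\mathcal X,\mathcal H)$ is contained in a pair of sets $(V,B)$ if $\mathcal X\subseteq V$ and $\mathcal H\subseteq B$. A normalized one-parameter subgroup is $\lambda(s)=\mathrm{Diag}(s^{r_0},\ldots,s^{r_{n+1}})$ with $r_i\in\mathbb Z$, $r_0\geq\cdots\geq r_{n+1}$, $\sum r_i=0$, not all zero; $\langle x_0^{d_0}\cdots x_{n+1}^{d_{n+1}},\lambda\rangle=\sum d_ir_i$. Put $\mu_t(X,H,\lambda)=\min\{\langle x^I,\lambda\rangle\mid x^I\in\mathcal X\}+t\min\{r_i\mid x_i\in\mathcal H\}$. The pair $(X,H)$ is $t$-stable (resp. $t$-semistable) if $\mu_t(g\cdot X,g\cdot H,\lambda)<0$ (resp. $\leq0$) for all $g\in G$ and all normalized $\lambda$; it is $t$-unstable if it is not $t$-semistable.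 The fundamental set $S_{n,d}$ consists of all $\lambda=\mathrm{Diag}(s^{r_0},\ldots,s^{r_{n+1}})$ with $(r_0,\ldots,r_{n+1})=c(\gamma_0,\ldots,\gamma_{n+1})\in\mathbb Z^{n+2}$ such that: (1) $\gamma_i=a_i/b_i\in\mathbb Q$ with $\gcd(a_i,b_i)=1$ and $c=\mathrm{lcm}(b_0,\ldots,b_{n+1})$; (2) $1=\gamma_0\geq\gamma_1\geq\cdots\geq\gamma_{n+1}=-1-\sum_{i=1}^n\gamma_i$; (3) $(\gamma_0,\ldots,\gamma_{n+1})$ is the unique solution (subject to $\gamma_0=1$ and $\sum\gamma_i=0$) of a consistent linear system of $n$ equations chosen from $\{\gamma_i-\gamma_{i+1}=0\mid i=0,\ldots,n\}\cup\{\sum_{i=0}^{n+1}(d_i-\bar d_i)\gamma_i=0\mid d_i,\bar d_i\in\mathbb Z_{\geq0},\ \sum d_i=\sum\bar d_i=d\}$. Put $N^+_t(\lambda,x_i)=(V^+_t(\lambda,x_i),B^+(x_i))$ and $N^\oplus_t(\lambda,x_i)=(V^\oplus_t(\lambda,x_i),B^\oplus(x_i))$, where $V^+_t(\lambda,x_i)=\{v\in\Xi_d\mid\langle v,\lambda\rangle+t\langle x_i,\lambda\rangle>0\}$, $V^\oplus_t(\lambda,x_i)=\{v\in\Xi_d\mid\langle v,\lambda\rangle+t\langle x_i,\lambda\rangle\geq0\}$, $B^+(x_i)=B^\oplus(x_i)=\{m\in\Xi_1\mid m\geq x_i\}$. *)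

(* Defs.v *)
From mathcomp Require Import all_boot all_order all_algebra.
From mathcomp Require Import mpoly.

Set Implicit Arguments.
Unset Strict Implicit.
Unset Printing Implicit Defensive.

Import Order.TTheory GRing.Theory Num.Theory.
Local Open Scope ring_scope.

(* Pairs (X, H).  A hypersurface (as a scheme) is represented by a form        *)
(* cutting it out; the form is unique up to a nonzero scalar, and everything   *)
(* below depends only on supports of forms, which rescaling does not change.   *)
(* The hyperplane is represented in the same way, by a form of degree 1.       *)

Record form_pair (K : closedFieldType) (n : nat) := FormPair {
  hypersurface : {mpoly K[n.+2]};
  hyperplane : {mpoly K[n.+2]} }.

Definition is_pair (K : closedFieldType) (n d : nat) (P : form_pair K n) : Prop :=
  [/\ hypersurface P != 0, hypersurface P \is d.-homog,
      hyperplane P != 0 & hyperplane P \is 1.-homog].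

(* (g . F)(x) = F (g^-1 x), so that the zero scheme of g . F is the image by g *)
(* of the zero scheme of F.                                                    *)
Definition act_form (K : closedFieldType) (n : nat)
    (g : 'M[K]_n.+2) (F : {mpoly K[n.+2]}) : {mpoly K[n.+2]} :=
  F \mPo [tuple \sum_(j < n.+2) invmx g i j *: 'X_j | i < n.+2].

Definition act (K : closedFieldType) (n : nat)
    (g : 'M[K]_n.+2) (P : form_pair K n) : form_pair K n :=
  FormPair (act_form g (hypersurface P)) (act_form g (hyperplane P)).

(* Pairs of sets of monomials, with componentwise containment.                 *)

Definition mono_pair (n : nat) : Type :=
  ({pred 'X_{1..n.+2}} * {pred 'X_{1..n.+2}})%type.

Definition contained (n : nat) (A B : mono_pair n) : Prop :=
  {subset A.1 <= B.1} /\ {subset A.2 <= B.2}.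

Definition monomials (K : closedFieldType) (n : nat) (P : form_pair K n) :
    mono_pair n :=
  ([pred m | m \in msupp (hypersurface P)] : {pred 'X_{1..n.+2}},
   [pred m | m \in msupp (hyperplane P)] : {pred 'X_{1..n.+2}}).

Definition in_family (K : closedFieldType) (n d : nat) (A : mono_pair n)
    (P : form_pair K n) : Prop :=
  is_pair d P /\ contained (monomials P) A.

(* The one-parameter subgroup Diag(s^r_0, ..., s^r_(n+1)) is represented by    *)
(* its vector of exponents r.                                                  *)

Definition ops (n : nat) : Type := {ffun 'I_n.+2 -> int}.

Definition normalized (n : nat) (r : ops n) : Prop :=
  [/\ forall i j : 'I_n.+2, (i <= j)%N -> r j <= r i,
      \sum_i r i = 0 & exists i, r i != 0].

Definition pairing (n : nat) (m : 'X_{1..n.+2}) (r : ops n) : int :=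
  \sum_i (m i)%:Z * r i.

(* For F != 0 the initial value of the iterated minimum is itself one of the   *)
(* pairings over which the minimum is taken.                                   *)
Definition min_pairing (K : closedFieldType) (n : nat)
    (F : {mpoly K[n.+2]}) (r : ops n) : int :=
  \big[Order.min/pairing (head 0%MM (msupp F)) r]_(m <- msupp F) pairing m r.

Definition mu (K : closedFieldType) (n : nat) (t : rat)
    (P : form_pair K n) (r : ops n) : rat :=
  (min_pairing (hypersurface P) r)%:~R + t * (min_pairing (hyperplane P) r)%:~R.

Definition t_stable (K : closedFieldType) (n : nat) (t : rat)
    (P : form_pair K n) : Prop :=
  forall (g : 'M[K]_n.+2) (r : ops n),
    \det g = 1 -> normalized r -> mu t (act g P) r < 0.

Definition t_semistable (K : closedFieldType) (n : nat) (t : rat)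
    (P : form_pair K n) : Prop :=
  forall (g : 'M[K]_n.+2) (r : ops n),
    \det g = 1 -> normalized r -> mu t (act g P) r <= 0.

Definition t_unstable (K : closedFieldType) (n : nat) (t : rat)
    (P : form_pair K n) : Prop := ~ t_semistable t P.

(* The equations gamma_i - gamma_(i+1) = 0 (0 <= i <= n), and                  *)
(* sum_i (m_i - m'_i) gamma_i = 0 for exponent vectors m, m' of degree d.      *)

Inductive equation (n : nat) :=
| EqStep of 'I_n.+1
| EqMono of 'X_{1..n.+2} & 'X_{1..n.+2}.

Definition allowed (n d : nat) (e : equation n) : Prop :=
  match e with
  | EqStep _ => True
  | EqMono m m' => mdeg m = d /\ mdeg m' = d
  end.

Definition holds (n : nat) (gam : {ffun 'I_n.+2 -> rat}) (e : equation n) : Prop :=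
  match e with
  | EqStep i => gam (widen_ord (leqnSn n.+1) i) - gam (lift ord0 i) = 0
  | EqMono m m' => \sum_i ((m i)%:R - (m' i)%:R) * gam i = 0
  end.

Definition solution (n : nat) (E : 'I_n -> equation n)
    (gam : {ffun 'I_n.+2 -> rat}) : Prop :=
  [/\ gam ord0 = 1, \sum_i gam i = 0 & forall k, holds gam (E k)].

Definition common_denominator (n : nat) (gam : {ffun 'I_n.+2 -> rat}) : nat :=
  \big[lcmn/1%N]_i `|denq (gam i)|%N.

(* The fundamental set S_{n,d}.                                                *)
Definition fundamental (n d : nat) (r : ops n) : Prop :=
  exists gam : {ffun 'I_n.+2 -> rat},
    [/\ forall i, (r i)%:~R = (common_denominator gam)%:R * gam i,
        [/\ gam ord0 = 1,
            forall i j : 'I_n.+2, (i <= j)%N -> gam j <= gam i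
          & gam ord_max = - 1 - \sum_(i < n.+2 | (1 <= i <= n)%N) gam i]
      & exists E : 'I_n -> equation n,
          [/\ forall k, allowed d (E k), solution E gam
            & forall gam', solution E gam' -> gam' = gam]].

(* B(x_i) = { m in Xi_1 | m >= x_i }: since x_0 > ... > x_(n+1), the monomials *)
(* x_j >= x_i are those with j <= i.                                           *)
Definition B_set (n : nat) (i : 'I_n.+2) : {pred 'X_{1..n.+2}} :=
  [pred m | [exists j : 'I_n.+2, (j <= i)%N && (m == U_(j)%MM)]].

Definition V_plus (n d : nat) (t : rat) (r : ops n) (i : 'I_n.+2) :
    {pred 'X_{1..n.+2}} :=
  [pred m | (mdeg m == d) &&
            (0 < (pairing m r)%:~R + t * (pairing U_(i)%MM r)%:~R)].

Definition V_oplus (n d : nat) (t : rat) (r : ops n) (i : 'I_n.+2) :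
    {pred 'X_{1..n.+2}} :=
  [pred m | (mdeg m == d) &&
            (0 <= (pairing m r)%:~R + t * (pairing U_(i)%MM r)%:~R)].

Definition N_plus (n d : nat) (t : rat) (r : ops n) (i : 'I_n.+2) : mono_pair n :=
  (V_plus d t r i, B_set i).

Definition N_oplus (n d : nat) (t : rat) (r : ops n) (i : 'I_n.+2) : mono_pair n :=
  (V_oplus d t r i, B_set i).

(* N r i is maximal for containment among all N r' i' with r' in S_{n,d}.      *)
Definition maximal_N (n d : nat) (N : ops n -> 'I_n.+2 -> mono_pair n)
    (r : ops n) (i : 'I_n.+2) : Prop :=
  fundamental d r /\
  forall (r' : ops n) (i' : 'I_n.+2), fundamental d r' ->
    contained (N r i) (N r' i') -> contained (N r' i') (N r i).

(* Main.v *)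
Require Import Defs.
From mathcomp Require Import all_boot all_order all_algebra.
From mathcomp Require Import mpoly zify lra.
From Stdlib Require Import Classical.
Import Order.TTheory GRing.Theory Num.Theory.
Local Open Scope ring_scope.
Set Implicit Arguments.
Unset Strict Implicit.
Unset Printing Implicit Defensive.

(** Fix a pair (X, H) in suitable coordinates and let x_i be the smallest
variable occurring in the equation of H.  On normalized vectors r the minimum
over H is attained at r_i, so that r |-> mu_t(X, H, r) is the minimum of the
linear forms r |-> <m, r> + t r_i, for m a monomial of X: a concave, piecewise
linear function on the Weyl chamber r_0 >= ... >= r_(n+1), sum r = 0.  After
rescaling to r_0 = 1 the chamber becomes a simplex.  The locus where a given
m0 attains the minimum is a polytope in it, bounded by the walls
r_k = r_(k+1) and <m - m0, r> = 0; these are the equations that appear in the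
definition of the fundamental set, and, since t r_i is common to all the linear
forms, they do not depend on t.  On this polytope mu_t is linear, hence at some
vertex it is at least as large as at the given r.  A vertex is the unique
solution of n of the equations of the walls, so clearing its denominators gives
a member of S_(n,d).  Thus every value of mu_t is bounded, up to a positive
factor, by a value at a member of the fundamental set (fundamental_above), and
nonnegativity or positivity of mu_t can be tested there.  Conversely a pair
whose monomials lie in N(r, x_i) satisfies
mu_t >= min over m of <m, r> + t r_i (margin_le_mu).

The vertex is found by exists_face: starting from a feasible point, move along
a direction that annihilates the equations already collected and does not
decrease the objective, until a wall which is not constant along this direction
is reached.  Its equation is independent of the previous ones, and the chamber
is pointed, so that after n steps the system has a unique solution.

The statements on maximal sets follow since only finitely many monomials of
degree d or 1 exist: a strictly increasing chain of pairs N(r, x_i) stops. *)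

(** * Vertices of polyhedra *)

Section Polyhedra.

Variables (F : realFieldType) (N : nat).
Implicit Types (a : 'rV[F]_N) (x y v : 'cV[F]_N) (E : seq 'rV[F]_N).

Definition ev a x : F := (a *m x) 0 0.

Lemma evE a x : ev a x = \sum_j a 0 j * x j 0.
Proof. by rewrite /ev mxE. Qed.

Lemma evD a x y : ev a (x + y) = ev a x + ev a y.
Proof. by rewrite /ev mulmxDr mxE. Qed.

Lemma evZ a (e : F) x : ev a (e *: x) = e * ev a x.
Proof. by rewrite /ev -scalemxAr mxE. Qed.

Lemma evN a x : ev a (- x) = - ev a x.
Proof. by rewrite /ev mulmxN mxE. Qed.

Lemma ev_span E x : (forall a, a \in E -> ev a x = 0) ->
  forall a, a \in <<E>>%VS -> ev a x = 0.
Proof.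
move=> Ex0 a; rewrite -[E]/(tval (in_tuple E)) => /coord_span ->.
rewrite /ev mulmx_suml summxE big1 // => i _.
by rewrite -scalemxAl mxE -/(ev _ _) Ex0 ?mulr0 // mem_nth.
Qed.

Lemma exists_common_zero E : (size E < N)%N ->
  exists2 v, v != 0 & forall a, a \in E -> ev a v = 0.
Proof.
move=> ltEN; pose M := \matrix_(i < size E) E`_i.
have: cokermx M != 0.
  by rewrite cokermx_eq0 /row_full neq_ltn (leq_ltn_trans (rank_leq_row M)).
case/matrix0Pn=> i [j Cij]; exists (col j (cokermx M)).
  by apply/matrix0Pn; exists i, 0; rewrite mxE.
move=> a /(nthP 0)[k ltkE <-].
have -> : E`_k = row (Ordinal ltkE) M by rewrite rowK.
by rewrite /ev -row_mul colE mulmxA mulmx_coker mul0mx !mxE.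
Qed.

Lemma free_common_zero E v : free E -> size E = N ->
  (forall a, a \in E -> ev a v = 0) -> v = 0.
Proof.
move=> freeE sizeE Ev0.
have basE : basis_of fullv E.
  by rewrite basisEfree freeE subvf dimvf dim_matrix sizeE mul1r leqnn.
apply/colP=> j; rewrite [RHS]mxE.
have := ev_span Ev0 (a := delta_mx 0 j).
rewrite (span_basis basE) memvf => /(_ isT) <-.
by rewrite /ev -rowE mxE.
Qed.

Variables (T : eqType) (c : T -> 'rV[F]_N) (s : seq T).

Definition feasible x := forall b, b \in s -> 0 <= ev (c b) x.

(** The ray leaves the polyhedron through the wall minimizing the ratio of the
value at x to the rate of decrease along v, as in the simplex method.  The
step e may be 0; the wall that is hit is in any case not constant along v,
which is what makes its equation independent of those annihilating v. *)
Lemma ray_exit x v : feasible x -> (exists2 b, b \in s & ev (c b) v < 0) ->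
  exists2 e : F, 0 <= e & feasible (x + e *: v) /\
    exists2 b, b \in s & ev (c b) v < 0 /\ ev (c b) (x + e *: v) = 0.
Proof.
move=> feasx [b0 /seq_tnthP[i0 ->] b0v].
pose f i := c (tnth (in_tuple s) i).
have [i /= iv imin] := arg_minP (fun i => ev (f i) x / - ev (f i) v)
  (P := fun i => ev (f i) v < 0) b0v.
exists (ev (f i) x / - ev (f i) v).
  by rewrite divr_ge0 ?feasx ?mem_tnth // oppr_ge0 ltW.
split=> [b /seq_tnthP[j ->]|]; last first.
  exists (tnth (in_tuple s) i); first exact: mem_tnth.
  split=> //; rewrite evD evZ -/(f i) invrN mulrN mulNr divfK ?subrr //.
  by rewrite lt_eqF.
rewrite evD evZ -/(f j).
have [jv|jv] := ltP (ev (f j) v) 0.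
  have := imin j jv; rewrite ler_pdivlMr ?oppr_gt0 // mulrN; lra.
rewrite addr_ge0 ?feasx ?mem_tnth // mulr_ge0 //.
by rewrite divr_ge0 ?feasx ?mem_tnth // oppr_ge0 ltW.
Qed.

Variables (E0 : seq 'rV[F]_N) (L : 'rV[F]_N).
Hypothesis freeE0 : free E0.
Hypothesis bounded : forall v, v != 0 -> (forall a, a \in E0 -> ev a v = 0) ->
  exists2 b, b \in s & ev (c b) v < 0.

(** Each step adds exactly one tight constraint to es while keeping the family
free; tracking freeness rather than the full set of tight constraints gives in
the end a system of precisely N - size E0 equations. *)
Lemma exists_face k x : feasible x -> (k + size E0 <= N)%N ->
  exists y es, [/\ feasible y /\ forall a, a \in E0 -> ev a y = ev a x,
    ev L x <= ev L y, size es = k /\ free (map c es ++ E0)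
    & forall b, b \in es -> b \in s /\ ev (c b) y = 0].
Proof.
move=> feasx; elim: k => [_|k IHk ltkN]; first by exists x, [::].
have [y [es [[feasy E0y] Ly [szes freees] es0]]] := IHk (ltnW ltkN).
have [|v0 nz_v0 v0_0] := @exists_common_zero (map c es ++ E0).
  by rewrite size_cat size_map szes.
(* Replacing v0 by its opposite, the objective does not decrease along v0. *)
wlog Lv0 : v0 nz_v0 v0_0 / 0 <= ev L v0 => [wlg|].
  case: (leP 0 (ev L v0)) => [/wlg|ltLv0]; first exact.
  apply: (wlg (- v0)); rewrite ?oppr_eq0 ?evN ?oppr_ge0 ?ltW // => a ain.
  by rewrite evN v0_0 ?oppr0.
have E0v a : a \in E0 -> ev a v0 = 0 by move=> ain; rewrite v0_0 ?mem_cat ?ain ?orbT.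
have [e e0 [feasz [b bs [bv bz]]]] := ray_exit feasy (bounded nz_v0 E0v).
exists (y + e *: v0), (b :: es); split.
- by split=> // a ain; rewrite evD evZ E0v // mulr0 addr0 E0y.
- by rewrite evD evZ ler_wpDr ?mulr_ge0.
- split; first by rewrite /= szes.
  rewrite /= free_cons freees andbT; apply/negP=> /(ev_span v0_0) bv0.
  by rewrite bv0 ltxx in bv.
move=> b'; rewrite inE => /predU1P[-> //|b'es]; have [b's b'y] := es0 _ b'es.
by split=> //; rewrite evD evZ b'y v0_0 ?mulr0 ?addr0 // mem_cat map_f.
Qed.

End Polyhedra.

(** * The action of the special linear group on forms *)

Lemma comp_mpolyA (R : comNzRingType) (k l m : nat) (lq : k.-tuple {mpoly R[l]})
    (lr : l.-tuple {mpoly R[m]}) (p : {mpoly R[k]}) :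
  (p \mPo lq) \mPo lr = p \mPo [tuple tnth lq i \mPo lr | i < k].
Proof.
rewrite !(comp_mpolyEX p) raddf_sum /=; apply: eq_bigr => e _.
rewrite comp_mpolyZ !comp_mpolyX rmorph_prod /=; congr (_ *: _).
by apply: eq_bigr => i _; rewrite rmorphXn /= tnth_mktuple.
Qed.

Lemma comp_mpoly_homog (R : comNzRingType) (k l d : nat)
    (lq : k.-tuple {mpoly R[l]}) (p : {mpoly R[k]}) :
  (forall i, tnth lq i \is 1.-homog) -> p \is d.-homog -> p \mPo lq \is d.-homog.
Proof.
move=> lq1 /dhomogP pd; rewrite comp_mpolyEX big_seq; apply: rpred_sum => m mp.
apply: dhomogZ; rewrite comp_mpolyX -(pd m mp) /= mdegE.
elim/big_rec2: _ => [|i e q _ IHq]; first exact: dhomog1.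
by apply: dhomogM => //; have := dhomogMn (m i) (lq1 i); rewrite mul1n.
Qed.

Section Action.

Variables (K : closedFieldType) (n : nat).
Implicit Types (g : 'M[K]_n.+2) (G : {mpoly K[n.+2]}) (P : form_pair K n).

Lemma act_formM g h G : g \in unitmx -> h \in unitmx ->
  act_form h (act_form g G) = act_form (h *m g) G.
Proof.
move=> gU hU; rewrite /act_form comp_mpolyA; congr (_ \mPo _).
apply: eq_mktuple => i; rewrite tnth_mktuple.
have -> : invmx (h *m g) = invmx g *m invmx h by exact: invrM.
rewrite raddf_sum /=.
under [RHS]eq_bigr => j _ do rewrite mxE scaler_suml.
rewrite exchange_big /=; apply: eq_bigr => j _.
rewrite comp_mpolyZ comp_mpolyXU (nth_mktuple _ _ j) scaler_sumr.
by apply: eq_bigr => k _; rewrite scalerA.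
Qed.

Lemma act_form1 G : act_form 1%:M G = G.
Proof.
rewrite -[RHS]comp_mpoly_id /act_form; congr (_ \mPo _).
apply: eq_mktuple => i; rewrite invmx1 (bigD1 i) //= mxE eqxx scale1r.
by rewrite big1 ?addr0 // => j /negPf ji; rewrite mxE eq_sym ji scale0r.
Qed.

Lemma act_form_homog d g G : G \is d.-homog -> act_form g G \is d.-homog.
Proof.
apply: comp_mpoly_homog => i; rewrite tnth_mktuple; apply: rpred_sum => j _.
by apply: dhomogZ; rewrite dhomogX; apply/eqP/mdeg1.
Qed.

Lemma act_form_neq0 g G : g \in unitmx -> G != 0 -> act_form g G != 0.
Proof.
move=> gU; apply: contra_neq => gG0; rewrite -[G]act_form1 -(mulVmx gU).
by rewrite -act_formM ?unitmx_inv // gG0 /act_form comp_mpoly0.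
Qed.

Lemma act1 P : act 1%:M P = P.
Proof. by case: P => X H; rewrite /act !act_form1. Qed.

Lemma is_pair_act d g P : \det g = 1 -> is_pair d P -> is_pair d (act g P).
Proof.
move=> g1 [X0 Xd H0 H1]; have gU : g \in unitmx by rewrite unitmxE g1 unitr1.
by split; rewrite ?act_form_neq0 ?act_form_homog.
Qed.

End Action.

(** * Minima of pairings *)

Section MinPairing.

Variables (K : closedFieldType) (n : nat).
Implicit Types (G : {mpoly K[n.+2]}) (r : ops n).

Lemma min_pairing_le G r m : m \in msupp G -> min_pairing G r <= pairing m r.
Proof. by move=> mG; rewrite /min_pairing; apply: ge_bigmin_seq. Qed.

Lemma min_pairing_attained G r : G != 0 ->
  exists2 m, m \in msupp G & min_pairing G r = pairing m r.
Proof.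
rewrite -msupp_eq0 /min_pairing; case: (msupp G) => // m0 s _ /=.
set s' := m0 :: s.
suff sub s0 : {subset s0 <= s'} -> exists2 m, m \in s' &
    \big[Order.min/pairing m0 r]_(m <- s0) pairing m r = pairing m r by exact: sub.
elim: s0 => [_|m s0 IHs sub].
  by exists m0; [exact: mem_head|rewrite big_nil].
have [m1 m1s min1] : exists2 m, m \in s' &
    \big[Order.min/pairing m0 r]_(m <- s0) pairing m r = pairing m r.
  by apply: IHs => m1 m1s; apply: sub; rewrite inE m1s orbT.
rewrite big_cons min1; case: (leP (pairing m r) (pairing m1 r)) => _.
  by exists m; first by apply: sub; rewrite mem_head.
by exists m1.
Qed.

End MinPairing.

(** * The Weyl chamber and the fundamental set *)

Section Chamber.

Variable n : nat.
Implicit Types (m : 'X_{1..n.+2}) (i j : 'I_n.+2) (k : 'I_n.+1) (r : ops n).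

Lemma antitone_sum0 (R : numDomainType) (f : 'I_n.+2 -> R) :
  (forall i j, (i <= j)%N -> f j <= f i) -> f ord0 <= 0 -> \sum_i f i = 0 ->
  forall i, f i = 0.
Proof.
move=> fanti f0 fsum i; apply/eqP; rewrite -oppr_eq0.
have/eqP : \sum_j - f j = 0 by rewrite sumrN fsum oppr0.
rewrite psumr_eq0 => [/allP/(_ i)|j _].
  by apply; rewrite mem_index_enum.
by rewrite oppr_ge0 (le_trans _ f0) // fanti.
Qed.

Lemma sum_ends (f : 'I_n.+2 -> rat) :
  \sum_i f i = f ord0 + f ord_max + \sum_(i < n.+2 | (1 <= i <= n)%N) f i.
Proof.
rewrite (bigD1 ord0) //= (bigD1 ord_max) //= addrA; congr (_ + _).
apply: eq_bigl => i; rewrite -!val_eqE /= lt0n -ltnS ltn_neqAle -ltnS.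
by rewrite ltn_ord andbT.
Qed.

Lemma steps_antitone (f : 'I_n.+2 -> rat) :
  (forall k, f (lift ord0 k) <= f (widen_ord (leqnSn n.+1) k)) ->
  forall i j, (i <= j)%N -> f j <= f i.
Proof.
move=> stepf i [j ltj] /= leij; elim: j ltj leij => [|j IHj] ltj leij.
  by have -> : i = Ordinal ltj by apply/val_inj/eqP; rewrite -leqn0.
move: leij; rewrite leq_eqVlt => /predU1P[ij|leij].
  by have -> : i = Ordinal ltj by exact: val_inj.
have ltj' : (j < n.+1)%N by [].
apply: le_trans (IHj (ltnW ltj) leij); have := stepf (Ordinal ltj').
set u := lift _ _; have -> : u = Ordinal ltj by exact: val_inj.
by set w := widen_ord _ _; have -> : w = Ordinal (ltnW ltj) by exact: val_inj.
Qed.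

Definition weight m : 'rV[rat]_n.+2 := \row_i (m i)%:R.

Lemma ev_weight m (x : 'cV_n.+2) : ev (weight m) x = \sum_i (m i)%:R * x i 0.
Proof. by rewrite evE; apply: eq_bigr => i _; rewrite mxE. Qed.

Lemma ev_weightU i (x : 'cV_n.+2) : ev (weight U_(i)) x = x i 0.
Proof.
rewrite ev_weight (bigD1 i) //= mnm1E eqxx mul1r big1 ?addr0 // => j ji.
by rewrite mnm1E eq_sym (negPf ji) mul0r.
Qed.

Lemma pairing_scale r (a : rat) (x : 'cV_n.+2) m :
  (forall i, (r i)%:~R = a * x i 0) -> (pairing m r)%:~R = a * ev (weight m) x.
Proof.
move=> rE; rewrite ev_weight /pairing rmorph_sum mulr_sumr /=.
by apply: eq_bigr => i _; rewrite rmorphM /= rE mulrCA.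
Qed.

Lemma pairingU r i : pairing U_(i) r = r i.
Proof.
rewrite /pairing (bigD1 i) //= mnm1E eqxx mul1r big1 ?addr0 // => j ji.
by rewrite mnm1E eq_sym (negPf ji) mul0r.
Qed.

(** The linear forms that are nonnegative where m0 has the least pairing among
the given monomials: steps of the chamber, and comparisons of m with m0. *)
Definition wall m0 (w : 'I_n.+1 + 'X_{1..n.+2}) : 'rV[rat]_n.+2 :=
  match w with
  | inl k => weight U_(widen_ord (leqnSn n.+1) k) - weight U_(lift ord0 k)
  | inr m => weight m - weight m0
  end.

Definition wall_equation m0 (w : 'I_n.+1 + 'X_{1..n.+2}) : equation n :=
  match w with inl k => EqStep k | inr m => EqMono m m0 end.

Lemma evBl (a b : 'rV[rat]_n.+2) x : ev (a - b) x = ev a x - ev b x.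
Proof. by rewrite /ev mulmxBl !mxE. Qed.

Lemma holds_wall m0 w (gam : {ffun 'I_n.+2 -> rat}) :
  holds gam (wall_equation m0 w) <-> ev (wall m0 w) (\col_i gam i) = 0.
Proof.
case: w => [k|m] /=; rewrite evBl ?ev_weightU ?mxE //.
rewrite !ev_weight -sumrB.
suff <- : \sum_i ((m i)%:R - (m0 i)%:R) * gam i = \sum_i ((m i)%:R *
    (\col_j gam j) i 0 - (m0 i)%:R * (\col_j gam j) i 0) by [].
by apply: eq_bigr => i _; rewrite mxE mulrBl.
Qed.

(** Rows of the system gamma_0 = 1, sum gamma = 0. *)
Definition normalization : seq 'rV[rat]_n.+2 := [:: delta_mx 0 ord0; const_mx 1].

Lemma ev_normalization (x y : 'cV_n.+2) :
  (forall a, a \in normalization -> ev a x = ev a y) <->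
  x ord0 0 = y ord0 0 /\ \sum_i x i 0 = \sum_i y i 0.
Proof.
have ev0 z : ev (delta_mx 0 ord0) z = z ord0 0 by rewrite /ev -rowE mxE.
have ev1 z : ev (const_mx 1) z = \sum_i z i 0.
  by rewrite evE; apply: eq_bigr => i _; rewrite mxE mul1r.
split=> [xy|[xy0 xy1] a].
  by rewrite -!ev0 -!ev1 !xy ?inE ?eqxx ?orbT.
by rewrite !inE => /orP[] /eqP->; rewrite ?ev0 ?ev1.
Qed.

Lemma free_normalization : free normalization.
Proof.
rewrite free_cons span_seq1 seq1_free; apply/andP; split.
  apply/vlineP => -[a /rowP aE]; have := aE ord0; have := aE ord_max.
  by rewrite !mxE /= !mulr1 => <- /eqP; rewrite oner_eq0.
by apply/eqP=> /rowP/(_ ord0)/eqP; rewrite !mxE oner_eq0.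
Qed.

(** The simplex gamma_0 = 1 of the chamber is bounded: a vector v with v_0 = 0
and sum 0 that increases along no step has all its entries at most 0, hence
equal to 0.  Thus every direction runs into a wall of the first kind. *)
Lemma chamber_bounded m0 (v : 'cV[rat]_n.+2) : v != 0 ->
  (forall a, a \in normalization -> ev a v = 0) ->
  exists k, ev (wall m0 (inl k)) v < 0.
Proof.
move=> nz_v nv; have [/existsP[k kv]|] := boolP [exists k, ev (wall m0 (inl k)) v < 0].
  by exists k.
rewrite negb_exists => /forallP stepv; case/negP: nz_v.
have [] : v ord0 0 = (0 : 'cV[rat]_n.+2) ord0 0 /\ \sum_i v i 0 = \sum_i (0 : 'cV[rat]_n.+2) i 0.
  by apply/ev_normalization => a /nv ->; rewrite /ev mulmx0 mxE.
rewrite mxE => v0; rewrite [RHS]big1 => [vsum|i _]; last by rewrite mxE.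
have v_anti : forall i j, (i <= j)%N -> v j 0 <= v i 0.
  apply: (steps_antitone (f := fun i => v i 0)) => k.
  by have := stepv k; rewrite /= evBl !ev_weightU -leNgt subr_ge0.
apply/eqP/colP=> i; rewrite [RHS]mxE.
by apply: (antitone_sum0 (f := fun i => v i 0)); rewrite // v0.
Qed.

(** On the polytope where m0 has the least pairing a linear form L is maximal at
a vertex.  A vertex solves n independent equations of walls besides the
normalization, which is what membership in the fundamental set asks for. *)
Lemma chamber_vertex d m0 (s : seq 'X_{1..n.+2}) (L : 'rV_n.+2) (x : 'cV_n.+2) :
  mdeg m0 = d -> (forall m, m \in s -> mdeg m = d) ->
  x ord0 0 = 1 -> \sum_i x i 0 = 0 ->
  (forall i j, (i <= j)%N -> x j 0 <= x i 0) ->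
  (forall m, m \in s -> ev (weight m0) x <= ev (weight m) x) ->
  exists gam : {ffun 'I_n.+2 -> rat}, let y := \col_i gam i in
    [/\ forall i j, (i <= j)%N -> gam j <= gam i,
        forall m, m \in s -> ev (weight m0) y <= ev (weight m) y,
        ev L x <= ev L y
      & exists E : 'I_n -> equation n,
          [/\ forall q : 'I_n, allowed d (E q), solution E gam
            & forall gam', solution E gam' -> gam' = gam]].
Proof.
move=> m0d sd x0 xsum xanti xmin.
pose walls := map inl (enum 'I_n.+1) ++ map inr s : seq ('I_n.+1 + 'X_{1..n.+2}).
have feasE z : feasible (wall m0) walls z <->
    (forall k, z (lift ord0 k) 0 <= z (widen_ord (leqnSn n.+1) k) 0) /\
    (forall m, m \in s -> ev (weight m0) z <= ev (weight m) z).
  split=> [fz|[zstep zmin] w].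
    split=> [k|m ms].
      have := fz (inl k); rewrite mem_cat map_f ?mem_enum // => /(_ isT).
      by rewrite /= evBl !ev_weightU subr_ge0.
    have := fz (inr m); rewrite mem_cat (map_f _ ms) orbT => /(_ isT).
    by rewrite /= evBl subr_ge0.
  rewrite mem_cat => /orP[]/mapP[u uin ->] /=; rewrite evBl subr_ge0 ?zmin //.
  by rewrite !ev_weightU.
have feasx : feasible (wall m0) walls x.
  by apply/feasE; split=> // k; apply: xanti; rewrite /= /bump /= add1n ltnW.
have bounded v : v != 0 -> (forall a, a \in normalization -> ev a v = 0) ->
    exists2 b, b \in walls & ev (wall m0 b) v < 0.
  move=> nz_v /(chamber_bounded m0 nz_v)[k kv]; exists (inl k) => //.
  by rewrite mem_cat map_f ?mem_enum.
have [|y [es [[feasy ynorm] Ly [szes freees] es0]]] :=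
  exists_face L free_normalization bounded (k := n) feasx.
  by rewrite addn2.
pose gam := [ffun i => y i 0].
have gamE : \col_i gam i = y by apply/colP=> i; rewrite mxE ffunE.
have [y0 ysum] := (ev_normalization y x).1 ynorm.
have /feasE[ystep ymin] := feasy.
exists gam; rewrite /= gamE; split=> //.
  by apply: steps_antitone => k; rewrite !ffunE.
pose E (q : 'I_n) := wall_equation m0 (tnth (Tuple (introT eqP szes)) q).
have esE q : tnth (Tuple (introT eqP szes)) q \in es by exact: mem_tnth.
exists E; split=> [q||gam' [gam'0 gam'sum gam'E]].
- rewrite /E; case: (tnth _ q) (esE q) => //= m /es0[ms _]; split=> //.
  move: ms; rewrite mem_cat => /orP[]/mapP[u us //] [->]; exact: sd.
- split=> [||q]; first by rewrite ffunE y0.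
    by under eq_bigr => i _ do rewrite ffunE; rewrite ysum.
  by apply/holds_wall; rewrite gamE; have [] := es0 _ (esE q).
suff v0 : \col_i gam' i - y = 0.
  apply/ffunP=> i; have /colP/(_ i) := v0; rewrite !mxE ffunE.
  by move/eqP; rewrite subr_eq0 => /eqP.
apply: free_common_zero freees _ _.
  by rewrite size_cat size_map szes addn2.
have evB a z z' : ev a (z - z') = ev a z - ev a z' by rewrite evD evN.
move=> a; rewrite mem_cat => /orP[/mapP[w wes ->]|anorm]; rewrite evB.
  have [_ ->] := es0 w wes; rewrite subr0; apply/holds_wall.
  have /tnthP[q ->] : w \in Tuple (introT eqP szes) by [].
  exact: gam'E.
apply/eqP; rewrite subr_eq0; apply/eqP; move: a anorm.
apply/ev_normalization; rewrite mxE gam'0 y0 x0 ysum xsum; split=> //.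
by rewrite -[RHS]gam'sum; apply: eq_bigr => i _; rewrite mxE.
Qed.

Lemma common_denominator_gt0 (gam : {ffun 'I_n.+2 -> rat}) :
  (0 < common_denominator gam)%N.
Proof.
rewrite /common_denominator.
elim/big_ind: _ => // [a b a0 b0|i _]; first by rewrite lcmn_gt0 a0.
by rewrite absz_gt0 denq_neq0.
Qed.

Lemma common_denominatorP (gam : {ffun 'I_n.+2 -> rat}) i :
  (common_denominator gam)%:R * gam i \is a Num.int.
Proof.
have /dvdnP[q ->] : (`|denq (gam i)| %| common_denominator gam)%N.
  exact: (biglcmn_sup i).
rewrite natrM -mulrA rpredM ?natr_int // pmulrn absz_denq mulrC -numqE.
exact: intr_int.
Qed.

Lemma fundamental_normalized d r : fundamental d r -> normalized r.
Proof.
case=> gam [rE [gam0 gamanti gammax] _].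
have C0 : 0 < (common_denominator gam)%:R :> rat by rewrite ltr0n common_denominator_gt0.
split=> [i j ij||].
- by rewrite -(ler_int rat) !rE ler_pM2l // gamanti.
- apply/eqP; rewrite -(intr_eq0 rat) rmorph_sum /=.
  under eq_bigr => i _ do rewrite rE.
  rewrite -mulr_sumr mulf_eq0 (gt_eqF C0) /= sum_ends gam0 gammax; lra.
exists ord0; rewrite -(intr_eq0 rat) rE gam0 mulr1; exact: lt0r_neq0.
Qed.

End Chamber.

Lemma normalized_head_gt0 n (r : ops n) : normalized r -> 0 < r ord0.
Proof.
case=> ranti rsum [i ri]; rewrite ltNge; apply/negP => r0.
by rewrite (antitone_sum0 ranti r0 rsum) eqxx in ri.
Qed.

(** * Comparing mu with its values on the fundamental set *)

Section Destabilizing.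

Variables (K : closedFieldType) (n d : nat) (t : rat).
Implicit Types (P : form_pair K n) (r : ops n) (i : 'I_n.+2).

Definition margin r i (m : 'X_{1..n.+2}) : rat :=
  (pairing m r)%:~R + t * (pairing U_(i)%MM r)%:~R.

Lemma margin_le_mu P r i : 0 < t -> is_pair d P -> normalized r ->
    {subset msupp (hyperplane P) <= B_set i} ->
  exists2 m, m \in msupp (hypersurface P) & margin r i m <= mu t P r.
Proof.
move=> t0 [X0 _ H0 _] [ranti _ _] HB.
have [m mX minX] := min_pairing_attained r X0.
exists m => //; rewrite /margin /mu minX lerD2l ler_pM2l // ler_int.
have [_ /HB/existsP[j /andP[ji /eqP->]] ->] := min_pairing_attained r H0.
by rewrite !pairingU ranti.
Qed.

(** Passing from r to a vertex of the polytope containing it.  The scalar c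
comes from normalizing r to r_0 = 1 and from clearing denominators at the
vertex; being positive, it is harmless for the sign of mu. *)
Lemma fundamental_above P r : 0 < t -> is_pair d P -> normalized r ->
  exists r' i (c : rat), [/\ 0 < c, fundamental d r',
    {subset msupp (hyperplane P) <= B_set i}
    & {in msupp (hypersurface P), forall m, c * mu t P r <= margin r' i m}].
Proof.
move=> t0 [X0 /dhomogP Xd H0 /dhomogP H1] rnorm; have r0 := normalized_head_gt0 rnorm.
have [ranti rsum _] := rnorm.
have degU m : m \in msupp (hyperplane P) -> exists i, m == U_(i)%MM.
  by move=> /H1/eqP/mdeg1P.
have [i iH imax] : exists2 i, U_(i)%MM \in msupp (hyperplane P) &
    forall j, U_(j)%MM \in msupp (hyperplane P) -> (j <= i)%N.
  have [m mH _] := min_pairing_attained r H0; have [i0 /eqP mE] := degU m mH.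
  rewrite mE in mH.
  have [i iH imax] := arg_maxnP (P := fun j => U_(j)%MM \in msupp (hyperplane P))
    (fun j : 'I_n.+2 => j : nat) mH.
  by exists i.
have HB : {subset msupp (hyperplane P) <= B_set i}.
  move=> m mH; have [j /eqP mE] := degU m mH; apply/existsP; exists j.
  by rewrite mE eqxx andbT imax // -mE.
have [m0 m0X minX] := min_pairing_attained r X0.
(* m0 attains the minimum at r, so that r lies in its polytope, where the
   objective m0 + t x_i equals the least margin. *)
pose rho : rat := (r ord0)%:~R; have rho0 : 0 < rho by rewrite ltr0z.
pose x : 'cV[rat]_n.+2 := \col_j ((r j)%:~R / rho).
have rE j : (r j)%:~R = rho * x j 0 by rewrite mxE mulrC divfK ?gt_eqF.
have [|||m mX|gam] := @chamber_vertex n d m0 (msupp (hypersurface P))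
    (weight m0 + t *: weight U_(i)%MM) x (Xd _ m0X) Xd.
- by rewrite mxE divff ?gt_eqF.
- under eq_bigr => j _ do rewrite mxE.
  by rewrite -mulr_suml -rmorph_sum /= rsum mul0r.
- by move=> j k jk; rewrite !mxE ler_pM2r ?invr_gt0 // ler_int ranti.
- rewrite -(ler_pM2l rho0) -!(pairing_scale _ rE) ler_int -minX.
  exact: min_pairing_le.
set y := \col_i gam i => -[gamanti ymin Lxy [E [Eall Esol Euniq]]].
have [gam0 gamsum _] := Esol.
pose C : rat := (common_denominator gam)%:R.
have C0 : 0 < C by rewrite ltr0n common_denominator_gt0.
pose r' : ops n := [ffun j => Num.floor (C * gam j)].
have r'E j : (r' j)%:~R = C * gam j.
  by rewrite ffunE floorK // common_denominatorP.
exists r', i, (C / rho); split=> //; first by rewrite divr_gt0.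
- exists gam; split=> //; last by exists E.
  by split=> //; move: gamsum; rewrite sum_ends gam0; lra.
have evL z : ev (weight m0 + t *: weight U_(i)%MM) z =
    ev (weight m0) z + t * ev (weight U_(i)%MM) z.
  by rewrite /ev mulmxDl -scalemxAl !mxE.
have r'yE j : (r' j)%:~R = C * y j 0 by rewrite r'E mxE.
move=> m mX; rewrite /margin !(pairing_scale _ r'yE) mulrCA -mulrDr.
rewrite -mulrA ler_pM2l // mulrC ler_pdivrMr //.
apply: (@le_trans _ _ ((ev (weight m0) x + t * ev (weight U_(i)%MM) x) * rho)).
  rewrite mulrDl -mulrA ![_ * rho]mulrC -!(pairing_scale _ rE) /mu minX lerD2l.
  by rewrite ler_pM2l // ler_int min_pairing_le.
rewrite ler_pM2r // -evL (le_trans Lxy) // evL lerD2r; exact: ymin.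
Qed.

End Destabilizing.

(** * Maximal pairs of sets of monomials *)

Section Maximal.

Variables (n d : nat) (N : ops n -> 'I_n.+2 -> mono_pair n).
Hypothesis Ndeg : forall r i, {in (N r i).1, forall m, mdeg m = d} /\
  {in (N r i).2, forall m, mdeg m = 1%N}.

(** Cutting off at the degrees d and 1 leaves finite sets and loses nothing for
the pairs N r i. *)
Definition mono_count (A : mono_pair n) : nat :=
  (#|[set m : 'X_{1..n.+2 < d.+1} | val m \in A.1]| +
   #|[set m : 'X_{1..n.+2 < 2} | val m \in A.2]|)%N.

Lemma subset_of_leq_card (b : nat) (A B : {pred 'X_{1..n.+2}}) :
    {in B, forall m, (mdeg m < b)%N} -> {subset A <= B} ->
    (#|[set m : 'X_{1..n.+2 < b} | val m \in B]| <=
     #|[set m : 'X_{1..n.+2 < b} | val m \in A]|)%N ->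
  {subset B <= A}.
Proof.
move=> Bb AB leBA m mB.
have : [set m : 'X_{1..n.+2 < b} | val m \in A] ==
    [set m : 'X_{1..n.+2 < b} | val m \in B].
  by rewrite eqEcard leBA andbT; apply/subsetP=> u; rewrite !inE => /AB.
by move/eqP/setP/(_ (BMultinom (Bb m mB))); rewrite !inE /= mB.
Qed.

Lemma card_subset (b : nat) (A B : {pred 'X_{1..n.+2}}) : {subset A <= B} ->
  (#|[set m : 'X_{1..n.+2 < b} | val m \in A]| <=
   #|[set m : 'X_{1..n.+2 < b} | val m \in B]|)%N.
Proof. by move=> AB; apply/subset_leq_card/subsetP=> u; rewrite !inE => /AB. Qed.

Lemma mono_count_lt r i r' i' : contained (N r i) (N r' i') ->
  ~ contained (N r' i') (N r i) -> (mono_count (N r i) < mono_count (N r' i'))%N.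
Proof.
case=> sub1 sub2; rewrite ltnNge => nsub; apply/negP => le_count; apply: nsub.
have [deg1 deg2] := Ndeg r' i'.
have le1 := card_subset d.+1 sub1; have le2 := card_subset 2 sub2.
split; [apply: (@subset_of_leq_card d.+1)|apply: (@subset_of_leq_card 2)] => //.
- by move=> m /deg1 ->.
- by rewrite -(leq_add2r #|[set m : 'X_{1..n.+2 < 2} | val m \in (N r' i').2]|)
    (leq_trans le_count) // leq_add2l.
- by move=> m /deg2 ->.
- by rewrite -(leq_add2l #|[set m : 'X_{1..n.+2 < d.+1} | val m \in (N r' i').1]|)
    (leq_trans le_count) // leq_add2r.
Qed.

Lemma mono_count_bound A : (mono_count A <=
  #|{: 'X_{1..n.+2 < d.+1}}| + #|{: 'X_{1..n.+2 < 2}}|)%N.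
Proof. by rewrite leq_add // max_card. Qed.

(** Replacing a non-maximal pair by a larger one increases its number of
monomials, which is bounded. *)
Lemma below_maximal r i : fundamental d r ->
  exists r' i', maximal_N d N r' i' /\ contained (N r i) (N r' i').
Proof.
set bound := (#|{: 'X_{1..n.+2 < d.+1}}| + #|{: 'X_{1..n.+2 < 2}}|)%N.
have [k] := ubnP (bound - mono_count (N r i)); elim: k r i => // k IHk r i lek fr.
have [max|nmax] := classic (maximal_N d N r i).
  by exists r, i; split; [exact: max | split=> m].
have [r1 [i1 [fr1 sub nsub]]] : exists r1 i1, [/\ fundamental d r1,
    contained (N r i) (N r1 i1) & ~ contained (N r1 i1) (N r i)].
  apply: NNPP => none; apply: nmax; split=> // r1 i1 fr1 sub.
  by apply: NNPP => nsub; apply: none; exists r1, i1.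
have [|//|r2 [i2 [max2 sub2]]] := IHk r1 i1.
  have := mono_count_lt sub nsub; have := mono_count_bound (N r1 i1).
  rewrite -/bound; move: lek; lia.
exists r2, i2; split=> //.
by split=> m; [move/(sub.1)/(sub2.1) | move/(sub.2)/(sub2.2)].
Qed.

End Maximal.

(** * The numerical criteria *)

Section Criteria.

Variables (K : closedFieldType) (n d : nat) (t : rat).
Hypothesis t0 : 0 < t.
Implicit Types (P : form_pair K n).

(** The common form of both criteria: pos is being nonnegative for stability
and being positive for semistability. *)
Lemma mu_criterion (pos : pred rat) P :
    (forall a b, a <= b -> pos a -> pos b) ->
    (forall c a, 0 < c -> pos a -> pos (c * a)) -> is_pair d P ->
  (exists (g : 'M[K]_n.+2) r,
     [/\ \det g = 1, normalized r & pos (mu t (act g P) r)]) <->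
  (exists (g : 'M[K]_n.+2) (r : ops n) (i : 'I_n.+2), [/\ \det g = 1, fundamental d r
     & contained (monomials (act g P))
         ([pred m | (mdeg m == d) && pos (margin t r i m)] : {pred _}, B_set i)]).
Proof.
move=> pos_up pos_scale Ppair; split=> [[g [r [g1 rnorm mu_pos]]]|].
  have gpair := is_pair_act g1 Ppair.
  have [r' [i [c [c0 fr' subH le_margin]]]] := fundamental_above t0 gpair rnorm.
  exists g, r', i; split=> //; split=> // m mX.
  have [_ /dhomogP Xd _ _] := gpair.
  apply/andP; split; first by apply/eqP; exact: Xd.
  by apply: pos_up (le_margin m mX) _; exact: pos_scale.
case=> g [r [i [g1 fr [subX subH]]]]; have rnorm := fundamental_normalized fr.
have [m mX le_mu] := margin_le_mu t0 (is_pair_act g1 Ppair) rnorm subH.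
have /andP[_ m_pos] := subX m mX.
by exists g, r; split=> //; exact: pos_up le_mu m_pos.
Qed.

Lemma not_stableP P : is_pair d P ->
  (~ t_stable t P <-> exists (g : 'M[K]_n.+2) (r : ops n) (i : 'I_n.+2),
     [/\ \det g = 1, fundamental d r
       & contained (monomials (act g P)) (N_oplus d t r i)]).
Proof.
move=> Ppair; apply: iff_trans (mu_criterion (pos := fun a => 0 <= a) _ _ Ppair).
- split=> [nst|[g [r [g1 rnorm mu0]]] st].
    apply: NNPP => none; apply: nst => g r g1 rnorm; rewrite ltNge.
    by apply/negP=> mu0; apply: none; exists g, r.
  by have := st g r g1 rnorm; rewrite ltNge mu0.
- by move=> a b ab a0; apply: le_trans ab.
- by move=> c a c0 a0; rewrite mulr_ge0 // ltW.
Qed.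

Lemma unstableP P : is_pair d P ->
  (t_unstable t P <-> exists (g : 'M[K]_n.+2) (r : ops n) (i : 'I_n.+2),
     [/\ \det g = 1, fundamental d r
       & contained (monomials (act g P)) (N_plus d t r i)]).
Proof.
move=> Ppair; apply: iff_trans (mu_criterion (pos := fun a => 0 < a) _ _ Ppair).
- split=> [nst|[g [r [g1 rnorm mu0]]] st].
    apply: NNPP => none; apply: nst => g r g1 rnorm; rewrite leNgt.
    by apply/negP=> mu0; apply: none; exists g, r.
  by have := st g r g1 rnorm; rewrite leNgt mu0.
- by move=> a b ab a0; apply: lt_le_trans ab.
- by move=> c a c0 a0; rewrite mulr_gt0.
Qed.

End Criteria.

Lemma contained_trans n (A B C : mono_pair n) :
  contained A B -> contained B C -> contained A C.
Proof.
by move=> [AB1 AB2] [BC1 BC2]; split=> m; [move/AB1/BC1|move/AB2/BC2].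
Qed.

Lemma N_degrees n d (V : {pred 'X_{1..n.+2}}) (i : 'I_n.+2) :
  {in V, forall m, mdeg m = d} ->
  {in (V, B_set i).1, forall m, mdeg m = d} /\
  {in (V, B_set i).2, forall m, mdeg m = 1%N}.
Proof.
by move=> Vd; split=> // m /existsP[j /andP[_ /eqP->]]; rewrite mdeg1.
Qed.

Theorem theorem1p4 (K : closedFieldType) (n d : nat) (t : rat)
    (hn : (1 <= n)%N) (hd : (1 <= d)%N)
    (ht0 : 0 < t) (ht : t < d%:R / (n.+1)%:R) :
  (forall P : form_pair K n, is_pair d P ->
     (~ t_stable t P <->
        exists (g : 'M[K]_n.+2) (r : ops n) (i : 'I_n.+2),
          [/\ \det g = 1, fundamental d r
            & contained (monomials (act g P)) (N_oplus d t r i)]) /\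
     (t_unstable t P <->
        exists (g : 'M[K]_n.+2) (r : ops n) (i : 'I_n.+2),
          [/\ \det g = 1, fundamental d r
            & contained (monomials (act g P)) (N_plus d t r i)])) /\
  (forall (r : ops n) (i : 'I_n.+2), maximal_N d (N_oplus d t) r i ->
     forall P : form_pair K n, in_family d (N_oplus d t r i) P -> ~ t_stable t P) /\
  (forall (r : ops n) (i : 'I_n.+2), maximal_N d (N_plus d t) r i ->
     forall P : form_pair K n, in_family d (N_plus d t r i) P -> t_unstable t P) /\
  (forall P : form_pair K n, is_pair d P -> ~ t_stable t P ->
     exists (g : 'M[K]_n.+2) (r : ops n) (i : 'I_n.+2),
       [/\ \det g = 1, maximal_N d (N_oplus d t) r i
         & in_family d (N_oplus d t r i) (act g P)]) /\
  (forall P : form_pair K n, is_pair d P -> t_unstable t P ->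
     exists (g : 'M[K]_n.+2) (r : ops n) (i : 'I_n.+2),
       [/\ \det g = 1, maximal_N d (N_plus d t) r i
         & in_family d (N_plus d t r i) (act g P)]).
Proof.
have N_oplus_deg r i := @N_degrees n d (V_oplus d t r i) i
  (fun m mV => eqP (andP mV).1).
have N_plus_deg r i := @N_degrees n d (V_plus d t r i) i
  (fun m mV => eqP (andP mV).1).
split; [|split; [|split; [|split]]].
- by move=> P Ppair; split; [exact: not_stableP|exact: unstableP].
- move=> r i [fr _] P [Ppair sub]; apply/(not_stableP ht0 Ppair).
  by exists 1%:M, r, i; rewrite det1 act1.
- move=> r i [fr _] P [Ppair sub]; apply/(unstableP ht0 Ppair).
  by exists 1%:M, r, i; rewrite det1 act1.
- move=> P Ppair /(not_stableP ht0 Ppair)[g [r [i [g1 fr sub]]]].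
  have [r' [i' [max' sub']]] := below_maximal N_oplus_deg i fr.
  exists g, r', i'; split=> //; split; first exact: is_pair_act.
  exact: contained_trans sub sub'.
- move=> P Ppair /(unstableP ht0 Ppair)[g [r [i [g1 fr sub]]]].
  have [r' [i' [max' sub']]] := below_maximal N_plus_deg i fr.
  exists g, r', i'; split=> //; split; first exact: is_pair_act.
  exact: contained_trans sub sub'.
Qed.
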